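(* Let $n\ge 4$ be an integer and let $\lambda=\langle n,n-1,n-2,n-3\rangle$. Then the rank-generating function $F_{\lambda}(q)$ is unimodal.
   Context: For a partition with distinct parts $\lambda=\langle \lambda_1,\dots,\lambda_b\rangle$ (so $\lambda_1>\lambda_2>\dots>\lambda_b\ge 1$), a partition $\mu$ is contained in the shifted Ferrers shape $\lambda$ if $\mu=\langle\mu_1,\dots,\mu_k\rangle$ has distinct parts, $k\le b$, and $\mu_i\le\lambda_i$ for all $i\le k$ (the empty partition is included). The rank-generating function is $F_{\lambda}(q)=\sum_{\mu} q^{|\mu|}$, the sum over all such $\mu$, where $|\mu|$ is the sum of the parts of $\mu$. A polynomial $\sum_i c_iq^i$ is unimodal if its coefficient sequence never strictly increases after a strict decrease, i.e. there is an index $m$ with $c_0\le c_1\le\dots\le c_m\ge c_{m+1}\ge\dots$. *)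

(* Defs.v *)
From HB Require Import structures.
From mathcomp Require Import all_boot all_order all_algebra.

Set Implicit Arguments.
Unset Strict Implicit.
Unset Printing Implicit Defensive.

Import Order.TTheory GRing.Theory Num.Theory.
Local Open Scope ring_scope.

Definition strict_partition (mu : seq nat) : bool :=
  sorted gtn mu && all (ltn 0%N) mu.

Definition in_shifted_shape (la mu : seq nat) : bool :=
  [&& strict_partition mu, (size mu <= size la)%N
    & all (fun i => nth 0%N mu i <= nth 0%N la i)%N (iota 0%N (size mu))].

(* The summation index is a finite type of sequences large enough to contain
   every partition in the shape; see in_shifted_shape_bseq. *)
Definition rank_gen_fun (la : seq nat) : {poly int} :=
  \sum_(mu : (size la).-bseq 'I_(head 0%N la).+1
         | in_shifted_shape la (map val mu))
    'X^(sumn (map val mu)).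

Lemma in_shifted_shape_bseq (la mu : seq nat) :
  in_shifted_shape la mu ->
  exists! s : (size la).-bseq 'I_(head 0%N la).+1, map val s = mu.
Proof.
case/and3P=> /andP[mu_sorted _] sz_mu /allP le_mu.
have bnd x : x \in mu -> (x < (head 0 la).+1)%N.
  case: mu mu_sorted sz_mu le_mu => // y mu /= y_mu sz_mu le_mu x_mu.
  have := le_mu 0%N; rewrite mem_head !nth0 => /(_ isT) /= le_y.
  rewrite ltnS (leq_trans _ le_y) //.
  move: x_mu; rewrite inE => /predU1P[-> //|x_mu].
  have gtn_trans : transitive gtn by move=> a b c ab bc; apply: ltn_trans bc ab.
  by apply: ltnW; apply: (allP (order_path_min gtn_trans y_mu)).
have Emu : map val (map (@inord (head 0 la)%N) mu) = mu.
  rewrite -map_comp -[RHS]map_id; apply/eq_in_map => x /bnd x_lt /=.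
  by rewrite inordK.
have sz : (size (map (@inord (head 0 la)%N) mu) <= size la)%N.
  by rewrite size_map.
exists (Bseq sz); split=> // s Es; apply: val_inj => /=.
by apply: (inj_map val_inj); rewrite Emu Es.
Qed.

Definition unimodal (p : {poly int}) : Prop :=
  exists m : nat,
    (forall i : nat, (i < m)%N -> p`_i <= p`_i.+1) /\
    (forall i : nat, (m <= i)%N -> p`_i.+1 <= p`_i).

(* Main.v *)
(** Allowing or forbidding the part 0 merges the sizes 1, 2 and the sizes 3, 4,
    so that F = 1 + e_2 + e_4, where e_k is the k-th elementary symmetric
    polynomial of 1, q, ..., q^n.  The coefficients of e_2 increase up to
    degree n and then drop by at most 1, at even degrees only, so it suffices
    that (1 - q) e_4 changes sign only after degree 2n and has positive
    coefficients at even degrees from 6 to 2n (with one exception).  These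
    coefficients count covariants of the binary quartic; stripping off the two
    invariants, of degrees 2 and 3, gives the recurrence [esym_incr4_rec],
    whose remainder is explicit.  In the exceptional case n = 4, the peak is
    at 7 instead of 2n. *)

Require Import Defs.
From mathcomp Require Import all_boot all_order all_algebra.
From mathcomp Require Import zify ring.

Set Implicit Arguments.
Unset Strict Implicit.
Unset Printing Implicit Defensive.

Import Order.TTheory GRing.Theory Num.Theory.
Local Open Scope ring_scope.

(** * Strict partitions and elementary symmetric polynomials *)

Fixpoint strict_partitions (n : nat) : seq (seq nat) :=
  if n is m.+1 then strict_partitions m ++ map (cons n) (strict_partitions m)
  else [:: [::]].

Lemma mem_strict_partitions n mu :
  (mu \in strict_partitions n) =
  strict_partition mu && all (fun x => x <= n)%N mu.
Proof.
have gtn_trans : transitive gtn by move=> a b c ab bc; apply: ltn_trans bc ab.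
elim: n mu => [|n IHn] mu /=.
  by rewrite inE /strict_partition; case: mu => // [[|x]] mu /=; rewrite andbF.
rewrite mem_cat IHn; case: mu => [|x mu].
  by rewrite orbC; case: mapP.
have -> : (x :: mu \in [seq n.+1 :: i | i <- strict_partitions n]) =
          (x == n.+1) && (mu \in strict_partitions n).
  apply/mapP/andP => [[nu nuP [-> ->]]|[/eqP-> muP]]; first by rewrite eqxx.
  by exists mu.
rewrite IHn /strict_partition /= !path_sortedE //.
have [->|x_neq] := eqVneq x n.+1.
  rewrite ltnn leqnn !andbF /=.
  have -> : all (gtn n.+1) mu = all (fun y => y <= n)%N mu by apply: eq_all.
  have [le_mu|] := boolP (all (fun y => y <= n)%N mu); last by rewrite !andbF.
  rewrite !andbT; suff -> : all (fun y => y <= n.+1)%N mu by rewrite andbT.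
  by apply: sub_all le_mu => y; apply: leqW.
rewrite orbF [in RHS](leq_eqVlt x) (negPf x_neq) /= ltnS.
have [le_x|_] := boolP (x <= n)%N; last by rewrite !andbF.
have [gt_mu|//] := boolP (all (gtn x) mu).
have le_mu : all (fun y => y <= n)%N mu.
  by apply: sub_all gt_mu => y /= /ltnW y_le; apply: leq_trans le_x.
suff -> : all (fun y => y <= n.+1)%N mu by rewrite le_mu.
by apply: sub_all le_mu => y; apply: leqW.
Qed.

Lemma strict_partitions_uniq n : uniq (strict_partitions n).
Proof.
elim: n => //= n IHn; rewrite cat_uniq IHn map_inj_uniq ?IHn ?andbT; last first.
  by move=> ? ? [].
apply/hasPn => _ /mapP[nu _ ->]; rewrite mem_strict_partitions /= ltnn.
by rewrite andbF.
Qed.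

(** Since the parts are distinct, a largest part at most n already forces the i-th part to be at
    most n - i + 1. *)
Lemma in_shifted_staircaseE n mu : (4 <= n)%N ->
  in_shifted_shape [:: n; n - 1; n - 2; n - 3]%N mu =
  (mu \in strict_partitions n) && (size mu <= 4)%N.
Proof.
move=> n_ge4; rewrite mem_strict_partitions /in_shifted_shape /strict_partition.
case: mu => [|a [|b [|c [|d [|e mu]]]]] //=; try lia.
Qed.

Definition strict_gf (k n : nat) : {poly int} :=
  \sum_(mu <- strict_partitions n | size mu == k) 'X^(sumn mu).

Lemma strict_gf0 n : strict_gf 0 n = 1.
Proof.
rewrite /strict_gf; elim: n => [|n IHn]; first by rewrite big_mkcond big_seq1.
by rewrite big_cat big_map IHn /= big_pred0 ?addr0.
Qed.

Lemma strict_gfS0 k : strict_gf k.+1 0 = 0.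
Proof. by rewrite /strict_gf big_mkcond big_seq1. Qed.

Lemma strict_gfSS k n :
  strict_gf k.+1 n.+1 = strict_gf k.+1 n + 'X^(n.+1) * strict_gf k n.
Proof.
rewrite /strict_gf big_cat big_map /= big_distrr /=; congr (_ + _).
by apply: eq_bigr => mu _; rewrite exprD.
Qed.

(** This is e_k of the n variables 1, q, ..., q^(n-1), that is, q^(k(k-1)/2) times a Gaussian
    binomial coefficient. *)
Fixpoint esym (k n : nat) : {poly int} :=
  match k, n with
  | 0, _ => 1
  | _.+1, 0 => 0
  | k'.+1, n'.+1 => esym k n' + 'X^n' * esym k' n'
  end.

Arguments esym : simpl never.

Lemma esym0 n : esym 0 n = 1.
Proof. by case: n. Qed.

Lemma esymSS k n : esym k.+1 n.+1 = esym k.+1 n + 'X^n * esym k n.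
Proof. by []. Qed.

(** Dropping 0, if present, from k + 1 distinct numbers among 0, ..., n leaves a strict partition
    with k or k + 1 parts. *)
Lemma strict_gfD k n : strict_gf k.+1 n + strict_gf k n = esym k.+1 n.+1.
Proof.
elim: n k => [|n IHn] k.
  rewrite strict_gfS0 add0r esymSS expr0 mul1r add0r.
  by case: k => [|k]; rewrite ?strict_gf0 ?strict_gfS0.
rewrite esymSS -IHn; case: k => [|k].
  rewrite strict_gfSS !strict_gf0 esym0; ring.
rewrite -IHn !strict_gfSS; ring.
Qed.

Lemma rank_gen_fun_esym n : (4 <= n)%N ->
  rank_gen_fun [:: n; n - 1; n - 2; n - 3]%N = 1 + esym 2 n.+1 + esym 4 n.+1.
Proof.
move=> n_ge4; set la := [:: _; _; _; _].
have -> : rank_gen_fun la =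
    \sum_(mu <- strict_partitions n | (size mu <= 4)%N) 'X^(sumn mu).
  rewrite /rank_gen_fun -[LHS]big_filter -[RHS]big_filter.
  rewrite -(big_map (fun s : (size la).-bseq 'I_(head 0%N la).+1 => map val s)
              xpredT (fun mu => 'X^(sumn mu))).
  apply: perm_big; apply: uniq_perm.
  - rewrite map_inj_uniq ?filter_uniq ?index_enum_uniq //.
    by move=> s t /(inj_map val_inj)/val_inj.
  - exact/filter_uniq/strict_partitions_uniq.
  move=> mu; rewrite mem_filter andbC -in_shifted_staircaseE //.
  apply/mapP/idP => [[s]|mu_in].
    by rewrite mem_filter => /andP[s_in _] ->.
  have [s [Es _]] := in_shifted_shape_bseq mu_in.
  by exists s; rewrite // mem_filter Es mu_in mem_index_enum.
transitivity (\sum_(k < 5) strict_gf k n).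
  rewrite /strict_gf (exchange_big_dep (fun mu => size mu <= 4)%N) /=.
    apply: eq_bigr => mu mu_le4.
    by rewrite -ltnS in mu_le4; rewrite (big_pred1 (Ordinal mu_le4)).
  by move=> k mu _ /eqP->; rewrite -ltnS.
rewrite -!strict_gfD !big_ord_recl big_ord0 /= !strict_gf0; ring.
Qed.

(** * Product formula and recurrences *)

Lemma expX1_neq0 n : (1 - 'X^(n.+1) : {poly int}) != 0.
Proof.
by rewrite subr_eq0 eq_sym; apply/eqP=> /(congr1 (fun p => size (polyseq p)));
   rewrite size_polyXn size_poly1.
Qed.

(** The product formula for Gaussian binomials, cleared of denominators. For fixed k it involves
    only q and q^n, so recurrences in n reduce to [ring]. *)
Lemma esym_closed k n :
  (\prod_(i < k) (1 - 'X^(i.+1))) * esym k n = \prod_(i < k) ('X^i - 'X^n).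
Proof.
elim: n k => [|n IHn] [|k]; rewrite ?big_ord0 ?esym0 ?mulr1 //.
  by rewrite /= [RHS]big_ord_recl expr0 subrr mul0r mulr0.
have shiftE : \prod_(i < k) ('X^(i.+1) - 'X^(n.+1)) =
              'X^k * \prod_(i < k) ('X^i - 'X^n) :> {poly int}.
  rewrite -[in 'X^k](card_ord k) -prodr_const -big_split /=.
  by apply: eq_bigr => i _; rewrite mulrBr -!exprS.
rewrite esymSS mulrDr IHn [in X in _ + X]big_ord_recr /= mulrCA.
rewrite [_ * esym k n]mulrAC IHn.
rewrite [RHS]big_ord_recl big_ord_recr /= shiftE !exprS expr0; ring.
Qed.

Definition esym_incr (k n : nat) : {poly int} := (1 - 'X) * esym k n.

(** Among pairs of exponents from 0, ..., n + 1, those avoiding both ends give the shifted term;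
    those meeting an end have the sums 1, ..., 2n + 1, once each. *)
Lemma esym_incr2_rec n :
  esym_incr 2 n.+2 = 'X^2 * esym_incr 2 n + ('X - 'X^(2 * n + 2)).
Proof.
rewrite /esym_incr; have := esym_closed 2 n.+2; have := esym_closed 2 n.
rewrite !big_ord_recr !big_ord0 /= !mul1r.
set D := ((1 - _) * (1 - _)).
move: (esym 2 n) (esym 2 n.+2) => A0 A2 E0 E2.
have nzD : D != 0 by rewrite mulf_neq0 ?expX1_neq0.
apply: (mulfI nzD); apply/eqP; rewrite -subr_eq0; apply/eqP.
transitivity ((1 - 'X) * (D * A2 - 'X^2 * (D * A0))
  - D * ('X - 'X^(2 * n + 2))); first ring.
rewrite E0 E2 /D.
rewrite [(2 * n)%N]mulnC !exprD !exprM !exprS expr0.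
by move: ('X^n) => y; ring.
Qed.

(** A further factor 1 - q turns the remainder of the recurrence for e_4 into a product. *)
Lemma geom_incr k c :
  (1 - 'X) * \sum_(j < k) ('X^j - 'X^(k + c - j)) =
  (1 - 'X^k) * (1 - 'X^(c.+1)) :> {poly int}.
Proof.
rewrite sumrB mulrBr -[1 - 'X^k]opprB subrX1.
have -> : (1 - 'X) * \sum_(j < k) 'X^(k + c - j) =
          (1 - 'X^k) * 'X^(c.+1) :> {poly int}.
  elim: k => [|k IHk]; first by rewrite big_ord0 expr0 subrr mul0r mulr0.
  by rewrite big_ord_recl mulrDr IHk subn0 !exprS exprD; ring.
rewrite -[1 - 'X^k]opprB subrX1; ring.
Qed.

(** Multiplication by the invariants of degrees 2 and 3, of weights 4 and 6, accounts for lowering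
    the index by 2 with a factor q^4 and by 3 with a factor q^6. *)
Lemma esym_incr4_rec n :
  esym_incr 4 n.+4.+1 = 'X^4 * esym_incr 4 n.+3
    + 'X^6 * (esym_incr 4 n.+2 - 'X^4 * esym_incr 4 n)
    + 'X^6 * \sum_(j < n.+2 | j != 1%N :> nat) ('X^j - 'X^(4 * n + 5 - j)).
Proof.
rewrite /esym_incr.
(* The missing term j = 1 is restored and subtracted, so that [geom_incr] applies to the full
   sum. *)
have -> : \sum_(j < n.+2 | j != 1%N :> nat) ('X^j - 'X^(4 * n + 5 - j)) =
    \sum_(j < n.+2) ('X^j - 'X^(n.+2 + (3 * n + 3) - j))
    - ('X - 'X^(4 * n + 4)) :> {poly int}.
  rewrite [in RHS](bigD1 (Ordinal (isT : 1 < n.+2)%N)) //= addrAC expr1.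
  have -> : (n.+2 + (3 * n + 3) - 1 = 4 * n + 4)%N by lia.
  rewrite subrr add0r; apply: eq_bigr => j _.
  by congr (_ - 'X^_); lia.
have := geom_incr n.+2 (3 * n + 3).
set S := \sum_(j < _) _ => ES.
have := esym_closed 4 n.+4.+1; have := esym_closed 4 n.+3.
have := esym_closed 4 n.+2; have := esym_closed 4 n.
rewrite !big_ord_recr !big_ord0 /= !mul1r.
set D := (_ * _ * _ * (1 - _)).
move: (esym 4 n) (esym 4 n.+2) (esym 4 n.+3) (esym 4 n.+4.+1) => A0 A2 A3 A5.
move=> E0 E2 E3 E5.
have nzD : (1 - 'X) * D != 0.
  by rewrite !mulf_neq0 ?expX1_neq0 // (expX1_neq0 0).
(* The factor [D] brings in the product formula and 1 - q collapses [S]; what is left is an identity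
   in q and y = q^n. *)
apply: (mulfI nzD); apply/eqP; rewrite -subr_eq0; apply/eqP.
transitivity ((1 - 'X) * ((1 - 'X) * (D * A5 - 'X^4 * (D * A3)
    - 'X^6 * (D * A2 - 'X^4 * (D * A0))) + 'X^6 * D * ('X - 'X^(4 * n + 4)))
  - 'X^6 * D * ((1 - 'X) * S)); first ring.
rewrite E0 E2 E3 E5 ES /D.
rewrite [(4 * n)%N]mulnC [(3 * n)%N]mulnC !(exprS, exprD, exprM) expr0.
move: ('X^n) => y; ring.
Qed.

(** * Small cases, and the coefficients of (1 - q) e_2 *)

Lemma esym_small k n : (n < k)%N -> esym k n = 0.
Proof.
elim: n k => [|n IHn] [|k] //= lt_nk.
by rewrite esymSS !IHn ?mulr0 ?addr0 // ltnW.
Qed.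

Lemma esym_diag n : esym n.+1 n.+1 = 'X^n * esym n n.
Proof. by rewrite esymSS esym_small ?add0r. Qed.

Lemma esym_incr_small k n : (n < k)%N -> esym_incr k n = 0.
Proof. by move=> lt_nk; rewrite /esym_incr esym_small ?mulr0. Qed.

Lemma esym_incr44 : esym_incr 4 4 = 'X^6 - 'X^7.
Proof. by rewrite /esym_incr !esym_diag esym0; ring. Qed.

Lemma esym_incr2_coef n i :
  [/\ (i < n)%N || odd i -> 0 <= (esym_incr 2 n)`_i,
      -1 <= (esym_incr 2 n)`_i,
      (n <= i)%N -> (esym_incr 2 n)`_i <= 0
    & (2 * n <= i.+1)%N -> (esym_incr 2 n)`_i = 0].
Proof.
elim/ltn_ind: n i => -[|[|n]] IHn i.
- by rewrite esym_incr_small // coef0; split.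
- by rewrite esym_incr_small // coef0; split.
have [IHa IHb IHc IHd] := IHn n (leqW (leqnn _)) (i - 2)%N.
rewrite esym_incr2_rec !(coefD, coefN) coefXnM coefX coefXn.
have [i2|i2] := ltnP i 2.
  by case: i i2 {IHa IHb IHc IHd} => [|[|//]] _ /=; split; lia.
have -> : (i == 1%N) = false by apply/eqP; lia.
(* At this degree the shifted polynomial has vanished by the fourth clause, so the coefficient is
   -1. *)
have [->|i_neq] := eqVneq i (2 * n + 2)%N.
  have -> : (2 * n + 2 - 2 = 2 * n)%N by lia.
  have [_ _ _ ->] := IHn n (leqW (leqnn _)) (2 * n)%N; last by lia.
  by split; lia.
rewrite subrr addr0.
by split=> *; [apply: IHa | apply: IHb | apply: IHc | apply: IHd]; lia.
Qed.

Lemma esym_incr2_coef1 n : (esym_incr 2 n.+2)`_1 = 1.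
Proof.
by rewrite esym_incr2_rec !(coefD, coefN) coefXnM coefX coefXn addn2.
Qed.

(** * Sign pattern of (1 - q) e_4 *)

Definition sign_change (c : nat) (p : {poly int}) : Prop :=
  forall i, ((i <= c)%N -> 0 <= p`_i) /\ ((c < i)%N -> p`_i <= 0).

Lemma sign_change0 c : sign_change c 0.
Proof. by move=> i; rewrite coef0. Qed.

Lemma sign_changeD c p q :
  sign_change c p -> sign_change c q -> sign_change c (p + q).
Proof.
move=> Hp Hq i; have [p0 p1] := Hp i; have [q0 q1] := Hq i; rewrite coefD.
split=> ci; first by rewrite addr_ge0 ?p0 ?q0.
by rewrite -[0]addr0 lerD ?p1 ?q1.
Qed.

Lemma sign_changeXn d c p : sign_change c p -> sign_change (d + c) ('X^d * p).
Proof.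
move=> Hp i; rewrite coefXnM; have [p0 p1] := Hp (i - d)%N.
by case: ltnP => id; split=> ci //; [apply: p0|apply: p1]; lia.
Qed.

Lemma sign_changeB c a b :
  (a <= c < b)%N -> sign_change c ('X^a - 'X^b).
Proof.
move=> /andP[ac cb] i; rewrite coefB !coefXn.
by split=> ci; do 2 case: eqVneq => ?; lia.
Qed.

(** The remainder in [esym_incr4_rec]. The two exponents of each term add up to 4n + 5, so the sign
    changes after 2n + 2. *)
Definition quartic_layer (n : nat) : {poly int} :=
  \sum_(j < n.+2 | j != 1%N :> nat) ('X^j - 'X^(4 * n + 5 - j)).

Lemma sign_change_layer n : sign_change (2 * n + 2) (quartic_layer n).
Proof.
rewrite /quartic_layer; apply: big_ind => [||j _]; first exact: sign_change0.
  exact: sign_changeD.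
by apply: sign_changeB; have := ltn_ord j; lia.
Qed.

Lemma quartic_layer_coef n i :
  (i <= n.+1)%N -> i != 1%N -> 1 <= (quartic_layer n)`_i.
Proof.
move=> i_le i_neq; rewrite /quartic_layer coef_sum.
rewrite (bigD1 (Ordinal (i_le : (i < n.+2)%N))) //= coefB !coefXn eqxx.
rewrite (_ : (i == _) = false) ?subr0 ?lerDl; last by apply/eqP; lia.
apply: sumr_ge0 => j _; rewrite coefB !coefXn.
by have := ltn_ord j; case: eqVneq => ?; case: eqVneq => ?; lia.
Qed.

(** What is left after stripping off the invariant of degree 2; stripping off that of degree 3 then
    leaves a shifted [quartic_layer]. *)
Definition esym_incr4_step (n : nat) : {poly int} :=
  esym_incr 4 n.+2 - 'X^4 * esym_incr 4 n.

Lemma esym_incr4_stepE n :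
  esym_incr 4 n.+2 = 'X^4 * esym_incr 4 n + esym_incr4_step n.
Proof. by rewrite addrC subrK. Qed.

Lemma esym_incr4_step_rec n :
  esym_incr4_step n.+3 = 'X^6 * esym_incr4_step n + 'X^6 * quartic_layer n.
Proof. rewrite /esym_incr4_step esym_incr4_rec /quartic_layer; ring. Qed.

Lemma esym_incr4_step2 : esym_incr4_step 2 = 'X^6 - 'X^7.
Proof.
by rewrite /esym_incr4_step esym_incr44 esym_incr_small // mulr0 subr0.
Qed.

(** The middle degree 2n + 2 of [esym 4 n.+2] moves by 4 or 6 when n grows by 2 or 3, just as q^4
    and q^6 move the threshold; hence all summands share one threshold. *)
Lemma sign_change_step n : sign_change (2 * n + 2) (esym_incr4_step n).
Proof.
elim/ltn_ind: n => -[|[|[|n]]] IHn.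
- rewrite /esym_incr4_step !esym_incr_small // mulr0 subr0.
  exact: sign_change0.
- rewrite /esym_incr4_step !esym_incr_small // mulr0 subr0.
  exact: sign_change0.
- by rewrite esym_incr4_step2; apply: sign_changeB.
have -> : (2 * n.+3 + 2 = 6 + (2 * n + 2))%N by lia.
rewrite esym_incr4_step_rec; apply: sign_changeD; apply: sign_changeXn.
  by apply: IHn; lia.
exact: sign_change_layer.
Qed.

Lemma sign_change_incr4 n : sign_change (2 * n + 2) (esym_incr 4 n.+2).
Proof.
elim/ltn_ind: n => -[|[|n]] IHn.
- by rewrite esym_incr_small //; apply: sign_change0.
- by rewrite esym_incr_small //; apply: sign_change0.
rewrite esym_incr4_stepE; apply: sign_changeD; last exact: sign_change_step.
have -> : (2 * n.+2 + 2 = 4 + (2 * n + 2))%N by lia.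
by apply: sign_changeXn; apply: IHn; lia.
Qed.

Lemma esym_incr4_step_coef6 n : 1 <= (esym_incr4_step n.+2)`_6.
Proof.
case: n => [|n]; first by rewrite esym_incr4_step2 coefB !coefXn.
rewrite esym_incr4_step_rec coefD !coefXnM /= -[1]add0r lerD //.
  by have [H _] := sign_change_step n 0; apply: H.
exact: quartic_layer_coef.
Qed.

(** The factor q^4 lowers both n and k by 2, which leaves k = 0 and k = 1 to [esym_incr4_step]. In
    the excluded case n = k = 1 the coefficient is 0. *)
Lemma esym_incr4_coef_gt0 n k :
  (k <= n)%N -> (k != 1%N) || (1 < n)%N -> 1 <= (esym_incr 4 n.+4)`_(6 + 2 * k).
Proof.
elim/ltn_ind: n k => n IHn k k_le k_or.
rewrite esym_incr4_stepE coefD.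
have stepP j : (j <= 2 * n + 6)%N -> 0 <= (esym_incr4_step n.+2)`_j.
  by move=> j_le; have [H _] := sign_change_step n.+2 j; apply: H; lia.
have prevP : 0 <= ('X^4 * esym_incr 4 n.+2)`_(6 + 2 * k).
  have [H _] := sign_changeXn 4 (sign_change_incr4 n) (6 + 2 * k).
  by apply: H; lia.
case: k k_le k_or prevP => [|[|k]] k_le k_or prevP.
- by rewrite -[1]add0r lerD // esym_incr4_step_coef6.
- rewrite -[1]add0r lerD //.
  case: n k_le k_or {IHn stepP prevP} => // n _ n_gt0.
  rewrite esym_incr4_step_rec coefD !coefXnM /= -[1]add0r lerD //.
    by have [H _] := sign_change_step n 2; apply: H; lia.
  by apply: quartic_layer_coef; lia.
case: n IHn k_le k_or stepP prevP => // -[//|n] IHn k_le _ stepP prevP.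
(* Here k is the original one minus 2. For k = 1 the induction could hit the excluded case, so
   degree 12 is reached from degree 6 by the factor q^6 instead. *)
have [k1|k_neq] := eqVneq k 1%N; last first.
  rewrite -[1]addr0 lerD //; last by apply: stepP; lia.
  rewrite coefXnM; case: ltnP => [|_]; first by lia.
  have -> : (6 + 2 * k.+2 - 4 = 6 + 2 * k)%N by lia.
  by apply: IHn; lia.
rewrite k1 in k_le prevP *; rewrite -[1]add0r lerD //.
case: n k_le {IHn stepP prevP} => // n _.
rewrite esym_incr4_step_rec coefD !coefXnM /= -[1]addr0 lerD //.
  exact: esym_incr4_step_coef6.
by have [H _] := sign_change_layer n.+2 6; apply: H; lia.
Qed.

(** * Unimodality *)

Lemma coef_incr (p : {poly int}) i : ((1 - 'X) * p)`_i.+1 = p`_i.+1 - p`_i.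
Proof. by rewrite mulrBl mul1r coefB coefXM. Qed.

Lemma unimodal_esym n : (4 <= n)%N ->
  unimodal (1 + esym 2 n.+1 + esym 4 n.+1).
Proof.
move=> hn; set F : {poly int} := 1 + _ + _.
have FS i : F`_i.+1 - F`_i =
    - (i == 0%N)%:R + (esym_incr 2 n.+1)`_i.+1 + (esym_incr 4 n.+1)`_i.+1.
  have FE : (1 - 'X) * F = (1 - 'X) + esym_incr 2 n.+1 + esym_incr 4 n.+1.
    by rewrite /F /esym_incr; ring.
  by rewrite -coef_incr FE 2!coefD coefB coefX coef1 eqSS sub0r.
(* From here on n is the original one minus 4, so the peak 2n + 8 is twice the original. *)
case: n hn @F FS => [|[|[|[|n]]]] // _ F FS.
have down i : (2 * n + 8 <= i)%N -> F`_i.+1 <= F`_i.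
  move=> i_ge; rewrite -subr_le0 FS.
  have [_ _ X_le0 _] := esym_incr2_coef n.+4.+1 i.+1.
  have [_ W_le0] := sign_change_incr4 n.+3 i.+1.
  have -> : (i == 0%N) = false by apply/eqP; lia.
  by rewrite oppr0 add0r -[0]addr0 lerD ?X_le0 ?W_le0; lia.
have up i : (i < 2 * n + 8)%N -> (i != 7) || (0 < n)%N -> F`_i <= F`_i.+1.
  move=> i_lt i_or; rewrite -subr_ge0 FS.
  have [W_ge0 _] := sign_change_incr4 n.+3 i.+1.
  have {}W_ge0 : 0 <= (esym_incr 4 n.+4.+1)`_i.+1 by apply: W_ge0; lia.
  case: i i_lt i_or W_ge0 => [|i] i_lt i_or W_ge0.
    (* The lost constant term 1 is made up for by the term q of e_2. *)
    by rewrite esym_incr2_coef1 addNr add0r.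
  rewrite oppr0 add0r.
  have [X_ge0 X_geN1 _ _] := esym_incr2_coef n.+4.+1 i.+2.
  have [X_pos|X_neg] := boolP ((i.+2 < n.+4.+1)%N || odd i.+2).
    by rewrite addr_ge0 // X_ge0.
  have [k ik] : exists k, (i.+2 = 6 + 2 * k)%N by exists (i.+2./2 - 3)%N; lia.
  have W_ge1 : 1 <= (esym_incr 4 n.+1.+4)`_i.+2.
    by rewrite ik; apply: esym_incr4_coef_gt0; lia.
  lia.
have [n0|n_gt0] := posnP n; last first.
  exists (2 * n + 8)%N; split=> [i i_lt|]; last exact: down.
  by apply: up; rewrite ?n_gt0 ?orbT.
exists 7%N; split=> i i_7; first by apply: up; lia.
have [i_gt|i_le] := ltnP 7 i; first by apply: down; lia.
have {i_7 i_le} -> : i = 7%N by lia.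
rewrite -subr_le0 FS n0 oppr0 add0r.
have [_ _ X_le0 _] := esym_incr2_coef 5 8.
(* With five variables only the remainder survives: (1 - q) e_4 = q^6 - q^11 has no term in q^8. *)
rewrite esym_incr4_rec !(@esym_incr_small 4) // !(mulr0, subr0, add0r).
rewrite coefXnM coef_sum /= big_mkcond !big_ord_recl big_ord0 /=.
by rewrite coefB !coefXn subrr !addr0 X_le0.
Qed.

Local Close Scope ring_scope.

Theorem theorem2p4 (n : nat) (hn : 4 <= n) :
  unimodal (rank_gen_fun [:: n; n - 1; n - 2; n - 3]).
Proof. by rewrite rank_gen_fun_esym //; apply: unimodal_esym. Qed.
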